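(* Let $\theta\in(0,\pi)$ have rational cosine $\cos\theta=s/r$, where $r,s\in\mathbb{Z}$, $0\le |s|<r$ and $\gcd(r,s)=1$, and let $N$ be a $\theta$-congruent number. Let $(a_0,b_0,c_0)$ be a rational $\theta$-triple for $N$ and put $d_0=b_0^2-a_0^2$; assume $d_0\neq 0$ and $d_0\neq 2a_0c_0$. Let $(a_1,b_1,c_1)$ be the rational $\theta$-triple for $N$ given by $$a_1=\frac{c_0^4-4(r^2-s^2)a_0^2b_0^2/r^2+4s\,a_0b_0c_0^2/r}{2c_0(b_0^2-a_0^2)},\quad b_1=\frac{4c_0^2a_0b_0}{2c_0(b_0^2-a_0^2)},\quad c_1=\frac{c_0^4+4(r^2-s^2)a_0^2b_0^2/r^2}{2c_0(b_0^2-a_0^2)}.$$ For $i=0,1$ let $(x_i,y_i)\in E_N^\theta(\mathbb{Q})$ be the rational point corresponding to $(a_i,b_i,c_i)$, that is, the unique point with $y_i\neq 0$ and $\phi(x_i,y_i)=(a_i,b_i,c_i)$. Then, in the group $E_N^\theta(\mathbb{Q})$, $$[2](x_0,y_0)=(x_1,-y_1).$$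
   Context: Fix $\theta\in(0,\pi)$ with $\cos\theta=s/r$, $r,s\in\mathbb{Z}$, $0\le|s|<r$, $\gcd(r,s)=1$. For a positive integer $N$, a rational $\theta$-triple for $N$ is a triple $(a,b,c)$ of rational numbers (not necessarily positive) with $a^2+b^2-\frac{2s}{r}ab=c^2$ and $ab=2rN$. A positive integer $N$ is a $\theta$-congruent number if there exists a rational $\theta$-triple for $N$ with $a,b,c>0$. The $\theta$-congruent number elliptic curve is $$E_N^\theta:\ y^2=x\,(x+(r+s)N)\,(x-(r-s)N),$$ whose rational points, including the point at infinity $\infty$ as identity, form a group under the chord-tangent law; $[2]P=P+P$. The map $$\phi:(x,y)\mapsto\left(\frac{y}{x},\ \frac{2rxN}{y},\ \frac{x^2+(r^2-s^2)N^2}{y}\right)$$ is a bijection from the set of points $(x,y)\in E_N^\theta(\mathbb{Q})\setminus\{\infty\}$ with $y\ne 0$ onto the set of rational $\theta$-triples for $N$, with inverse $$\psi:(a,b,c)\mapsto\left(\frac{rN(a+c-sb/r)}{b},\ \frac{2r^2N^2(a+c-sb/r)}{b^2}\right).$$ *)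

(* Defs.v *)
From HB Require Import structures.
From mathcomp Require Import all_boot all_order all_algebra.
From mathcomp Require Import ring.

Set Implicit Arguments.
Unset Strict Implicit.
Unset Printing Implicit Defensive.
Import Order.TTheory GRing.Theory Num.Theory.
Local Open Scope ring_scope.

(** * Cubic curves y^2 = x^3 + a2 x^2 + a4 x + a6 and the chord-tangent law *)

Record cubic_curve (F : fieldType) := CubicCurve { ca2 : F; ca4 : F; ca6 : F }.

Section ChordTangent.
Variables (F : fieldType) (E : cubic_curve F).

(* [None] is the point at infinity. *)
Definition on_curve (p : option (F * F)) : bool :=
  if p is Some (x, y)
  then y ^+ 2 == x ^+ 3 + ca2 E * x ^+ 2 + ca4 E * x + ca6 E
  else true.

Definition ec_point : Type := {p : option (F * F) | on_curve p}.

(* Third intersection point of the cubic with the line of slope [l] through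
   (x1, y1) and a point of abscissa x2, reflected in the x-axis. *)
Definition line_sum (l x1 y1 x2 : F) : option (F * F) :=
  let x3 := l ^+ 2 - ca2 E - x1 - x2 in
  Some (x3, l * (x1 - x3) - y1).

Definition chord_tangent (p q : option (F * F)) : option (F * F) :=
  match p, q with
  | None, _ => q
  | _, None => p
  | Some (x1, y1), Some (x2, y2) =>
      if x1 == x2 then
        if y1 == - y2 then None
        else line_sum ((3 * x1 ^+ 2 + 2 * ca2 E * x1 + ca4 E) / (2 * y1))
                      x1 y1 x2
      else line_sum ((y2 - y1) / (x2 - x1)) x1 y1 x2
  end.

Lemma on_curve_chord_tangent p q :
  on_curve p -> on_curve q -> on_curve (chord_tangent p q).
Proof.
case: p q => [[x1 y1]|] [[x2 y2]|] //= /eqP h1 /eqP h2.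
have e6 : ca6 E = y1 ^+ 2 - x1 ^+ 3 - ca2 E * x1 ^+ 2 - ca4 E * x1.
  by rewrite h1; ring.
case: (eqVneq x1 x2) => [ex|nx]; last first.
  have nx' : x2 - x1 != 0 by rewrite subr_eq0 eq_sym.
  have e4 : ca4 E = (y2 ^+ 2 - y1 ^+ 2 - (x2 ^+ 3 - x1 ^+ 3)
                     - ca2 E * (x2 ^+ 2 - x1 ^+ 2)) / (x2 - x1).
    by apply: (mulIf nx'); rewrite divfK // h1 h2; ring.
  by rewrite /line_sum /= e6 e4; apply/eqP; field.
case: (eqVneq y1 (- y2)) => [//|ny].
have ey : y1 = y2.
  have : (y1 - y2) * (y1 + y2) = 0.
    have -> : (y1 - y2) * (y1 + y2) = y1 ^+ 2 - y2 ^+ 2 by ring.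
    by rewrite h1 h2 ex subrr.
  move/eqP; rewrite mulf_eq0 subr_eq0 addr_eq0 (negbTE ny) orbF.
  by move/eqP.
have n2y : 2 * y1 != 0.
  apply: contraNneq ny => e; rewrite -addr_eq0 -ey -[X in _ == X]e.
  by apply/eqP; ring.
rewrite /line_sum /= -ex; set l := _ / (2 * y1).
have e4 : ca4 E = 2 * y1 * l - 3 * x1 ^+ 2 - 2 * ca2 E * x1.
  by rewrite /l mulrC divfK //; ring.
by rewrite e6 e4; apply/eqP; ring.
Qed.

Definition ec_add (P Q : ec_point) : ec_point :=
  exist on_curve (chord_tangent (sval P) (sval Q))
        (on_curve_chord_tangent (svalP P) (svalP Q)).

Definition ec_double (P : ec_point) : ec_point := ec_add P P.

End ChordTangent.

(** * Rational theta-triples and theta-congruent numbers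

    Throughout, [r] and [s] are the integers with cos theta = s / r. *)

Definition theta_triple (r s : int) (N : nat) (a b c : rat) : Prop :=
  a ^+ 2 + b ^+ 2 - 2 * s%:~R / r%:~R * a * b = c ^+ 2 /\
  a * b = 2 * r%:~R * N%:R.

Definition theta_congruent (r s : int) (N : nat) : Prop :=
  exists a b c : rat, [/\ 0 < a, 0 < b, 0 < c & theta_triple r s N a b c].

Definition theta_curve (r s : int) (N : nat) : cubic_curve rat :=
  CubicCurve (2 * s%:~R * N%:R) (- ((r%:~R ^+ 2 - s%:~R ^+ 2) * N%:R ^+ 2)) 0.

Lemma on_theta_curveE r s N (x y : rat) :
  on_curve (theta_curve r s N) (Some (x, y)) =
  (y ^+ 2 == x * (x + (r + s)%:~R * N%:R) * (x - (r - s)%:~R * N%:R)).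
Proof. by rewrite /= rmorphD rmorphB /=; congr (_ == _); ring. Qed.

Definition theta_phi (r s : int) (N : nat) (p : rat * rat) : rat * rat * rat :=
  let: (x, y) := p in
  (y / x, 2 * r%:~R * x * N%:R / y,
   (x ^+ 2 + (r%:~R ^+ 2 - s%:~R ^+ 2) * N%:R ^+ 2) / y).

(* Every theta-triple comes from exactly one point with nonzero ordinate. *)
Lemma theta_phi_bij (r s : int) (N : nat) (a b c : rat) :
  `|s| < r -> (0 < N)%N -> theta_triple r s N a b c ->
  exists! p : rat * rat,
    [/\ on_curve (theta_curve r s N) (Some p), p.2 != 0 &
        theta_phi r s N p = (a, b, c)].
Proof.
move=> hsr hN [h1 h2].
have r0 : (r%:~R : rat) != 0.
  by rewrite intr_eq0 gt_eqF // (le_lt_trans _ hsr).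
have D0 : (r%:~R ^+ 2 - s%:~R ^+ 2 : rat) != 0.
  rewrite gt_eqF // subr_gt0 -!rmorphXn ltr_int -(real_normK (num_real s)).
  by rewrite ltr_pXn2r // nnegrE ?normr_ge0 // ltW // (le_lt_trans _ hsr).
have N0 : (N%:R : rat) != 0 by rewrite pnatr_eq0 -lt0n.
rewrite /on_curve /theta_phi /theta_curve /=.
move: (r%:~R : rat) (s%:~R : rat) (N%:R : rat) r0 D0 N0 h1 h2.
move=> {hsr hN}{}r {}s n r0 D0 n0 h1 h2.
have ab0 : a * b != 0 by rewrite h2 !mulf_neq0.
have /andP[a0 b0] : (a != 0) && (b != 0).
  by rewrite -negb_or -mulf_eq0.
have en : n = a * b / (2 * r) by rewrite h2; field.
have {h2}_ := h2.
set D := r ^+ 2 - s ^+ 2 in D0 *.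
pose u := a + c - s * b / r; pose v := c - a + s * b / r.
have uv : u * v = D * b ^+ 2 / r ^+ 2.
  have -> : u * v = c ^+ 2 - (a - s * b / r) ^+ 2 by rewrite /u /v; ring.
  by rewrite -h1 /D; field.
have eD : D = u * v * r ^+ 2 / b ^+ 2 by rewrite uv; field; rewrite ?r0 ?b0.
have u0 : u != 0.
  by apply: contraNneq D0 => e; rewrite eD e !mul0r.
have es : s = r * (a - (u - v) / 2) / b by rewrite /u /v; field; rewrite ?r0 ?b0.
have ec : c = (u + v) / 2 by rewrite /u /v; field.
exists (a * u / 2, a ^+ 2 * u / 2); split.
  split.
  - by apply/eqP; rewrite en eD es; field; rewrite r0 b0.
  - by rewrite /= !mulf_neq0 ?expf_neq0.
  - by rewrite eD en ec; congr (_, _, _); field; rewrite ?a0 ?u0 ?r0 ?b0.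
case=> x y [/= /eqP hE y0 [ea eb ecc]].
have x0 : x != 0.
  by apply: contraNneq a0 => e; rewrite -ea e invr0 mulr0.
have ey : y = a * x by rewrite -ea divfK.
have h3 : c * (a * x) = x ^+ 2 + D * n ^+ 2 by rewrite -ey -ecc divfK.
have h4 : a ^+ 2 * x = x ^+ 2 + 2 * s * n * x - D * n ^+ 2.
  by apply: (mulIf x0); move: hE; rewrite ey => hE; 
     transitivity ((a * x) ^+ 2); [ring|rewrite hE; ring].
have h5 : (a * (a + c) - 2 * s * n - 2 * x) * x = 0.
  transitivity (a ^+ 2 * x + c * (a * x) - (2 * s * n + 2 * x) * x); first ring.
  by rewrite h3 h4; ring.
have ex : x = a * u / 2.
  move/eqP: h5; rewrite mulf_eq0 (negbTE x0) orbF => /eqP h5.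
  have -> : x = (a * (a + c) - 2 * s * n) / 2.
    by rewrite -[LHS]subr0 -[X in _ - X](mul0r (- 2^-1)) -h5; field.
  by rewrite en /u; field.
by rewrite ey ex; congr (_, _); ring.
Qed.

(* [triple_a1], [triple_b1], [triple_c1]: the triple (a1, b1, c1) obtained from
   (a, b, c) = (a0, b0, c0). *)
Definition triple_a1 (r s : int) (a b c : rat) : rat :=
  (c ^+ 4 - 4 * (r%:~R ^+ 2 - s%:~R ^+ 2) * a ^+ 2 * b ^+ 2 / r%:~R ^+ 2
   + 4 * s%:~R * a * b * c ^+ 2 / r%:~R) / (2 * c * (b ^+ 2 - a ^+ 2)).

Definition triple_b1 (a b c : rat) : rat :=
  (4 * c ^+ 2 * a * b) / (2 * c * (b ^+ 2 - a ^+ 2)).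

Definition triple_c1 (r s : int) (a b c : rat) : rat :=
  (c ^+ 4 + 4 * (r%:~R ^+ 2 - s%:~R ^+ 2) * a ^+ 2 * b ^+ 2 / r%:~R ^+ 2)
  / (2 * c * (b ^+ 2 - a ^+ 2)).

Lemma theta_triple1 (r s : int) (N : nat) (a b c : rat) :
  `|s| < r -> (0 < N)%N -> theta_triple r s N a b c -> b ^+ 2 - a ^+ 2 != 0 ->
  theta_triple r s N (triple_a1 r s a b c) (triple_b1 a b c)
                     (triple_c1 r s a b c).
Proof.
move=> hsr hN [h1 h2] d0.
have r0 : (r%:~R : rat) != 0.
  by rewrite intr_eq0 gt_eqF // (le_lt_trans _ hsr).
have D0 : 0 < (r%:~R ^+ 2 - s%:~R ^+ 2 : rat).
  rewrite subr_gt0 -!rmorphXn ltr_int -(real_normK (num_real s)).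
  by rewrite ltr_pXn2r // nnegrE ?normr_ge0 // ltW // (le_lt_trans _ hsr).
have N0 : (N%:R : rat) != 0 by rewrite pnatr_eq0 -lt0n.
rewrite /theta_triple /triple_a1 /triple_b1 /triple_c1.
move: (r%:~R : rat) (s%:~R : rat) (N%:R : rat) r0 D0 N0 h1 h2.
move=> {hsr hN}{}r {}s n r0 D0 n0 h1 h2.
have ab0 : a * b != 0 by rewrite h2 !mulf_neq0.
have /andP[a0 b0] : (a != 0) && (b != 0).
  by rewrite -negb_or -mulf_eq0.
have c0 : c != 0.
  rewrite -sqrf_eq0 -h1.
  have -> : a ^+ 2 + b ^+ 2 - 2 * s / r * a * b =
    (a - s / r * b) ^+ 2 + (r ^+ 2 - s ^+ 2) * (b / r) ^+ 2 by field.
  rewrite gt_eqF // ltr_wpDl ?sqr_ge0 // mulr_gt0 // exprn_even_gt0 //=.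
  by rewrite mulf_neq0 ?invr_eq0.
have ea : (c ^+ 4 - 4 * (r ^+ 2 - s ^+ 2) * a ^+ 2 * b ^+ 2 / r ^+ 2 +
   4 * s * a * b * c ^+ 2 / r) = (b ^+ 2 - a ^+ 2) ^+ 2.
  have -> : c ^+ 4 = (c ^+ 2) ^+ 2 by ring.
  by rewrite -h1; field.
rewrite ea; split; last by rewrite -h2; field; rewrite ?c0 ?d0.
have es : s = r * (a ^+ 2 + b ^+ 2 - c ^+ 2) / (2 * a * b).
  by rewrite -h1; field; rewrite a0 b0.
by rewrite es; field; rewrite ?a0 ?b0 ?c0 ?r0 ?d0.
Qed.

(* Main.v *)
Require Import Defs.
From mathcomp Require Import all_boot all_order all_algebra.
From mathcomp Require Import all_classical all_reals all_analysis.
From mathcomp Require Import ring.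

(** Put [n = N], [D = r^2 - s^2], and let [(a, b, c)] be the triple of a point
    [(x, y)] of the curve [y^2 = x^3 + 2 s n x^2 - D n^2 x].  By the definition
    of [phi], [y = a x] and [c y = x^2 + D n^2].  Adding the second of these to
    the equation of the curve divided by [x] eliminates [D n^2] and gives
    [2 x = a (a + c) - 2 s n] ([theta_phi_coords]).

    In these coordinates the tangent at [(x, y)] has the simple slope
    [a + c / 2] ([theta_tangent_slope]), because
    [x (3 x^2 + 4 s n x - D n^2) = 2 y^2 + x (x^2 + D n^2)].  The abscissa of
    the double is then [(a + c / 2)^2 - 2 s n - 2 x = c^2 / 4], and its ordinate
    works out to [c (a^2 - b^2) / 8] ([theta_double_coords]).

    On the other side, the triple relation turns the numerator of [a1] into the
    square [(b^2 - a^2)^2], so [a1 = (b^2 - a^2) / (2 c)], while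
    [a1 + c1 - s b1 / r = c^3 / (b^2 - a^2)] by cancellation.  The inverse map [psi] sends
    [(a1, b1, c1)] to the point of abscissa [a1 (a1 + c1 - s b1 / r) / 2], which
    is [c^2 / 4], and of ordinate [a1 c^2 / 4 = c (b^2 - a^2) / 8]
    ([theta_triple1_coords]).  The two points are thus opposite. *)

Set Implicit Arguments.
Unset Strict Implicit.
Unset Printing Implicit Defensive.
Import Order.TTheory GRing.Theory Num.Theory.
Local Open Scope ring_scope.

(** With [y = a x], the equation of the curve divided by [x] is
    [a^2 x = x^2 + 2 s n x - D n^2].  Adding the equation for [c] eliminates
    [D n^2], and what is left is [x] times the last equation. *)
Lemma theta_phi_coords (r s : int) (N : nat) (x y a b c : rat) :
  on_curve (theta_curve r s N) (Some (x, y)) -> y != 0 ->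
  theta_phi r s N (x, y) = (a, b, c) ->
  [/\ x != 0, y = a * x,
      c * y = x ^+ 2 + (r%:~R ^+ 2 - s%:~R ^+ 2) * N%:R ^+ 2 &
      2 * x = a * (a + c) - 2 * s%:~R * N%:R].
Proof.
rewrite /on_curve /theta_phi /theta_curve /= => /eqP.
move: (r%:~R : rat) (s%:~R : rat) (N%:R : rat) => {}r {}s n hE y0 [ea _ ec].
have x0 : x != 0.
  apply: contraNneq y0 => e; rewrite -sqrf_eq0 hE e.
  by apply/eqP; ring.
have ey : y = a * x by rewrite -ea divfK.
have ecy : c * y = x ^+ 2 + (r ^+ 2 - s ^+ 2) * n ^+ 2 by rewrite -ec divfK.
split=> //; apply: (mulIf x0).
have hax : a ^+ 2 * x * x = x * (x ^+ 2 + 2 * s * n * x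
                                 - (r ^+ 2 - s ^+ 2) * n ^+ 2).
  by transitivity (y ^+ 2); [rewrite ey; ring | rewrite hE; ring].
have {}hax : a ^+ 2 * x = x ^+ 2 + 2 * s * n * x - (r ^+ 2 - s ^+ 2) * n ^+ 2.
  by apply: (mulIf x0); rewrite hax; ring.
transitivity (a ^+ 2 * x + c * y - 2 * s * n * x); last by rewrite ey; ring.
by rewrite hax ecy; ring.
Qed.

Lemma theta_phi_mul (r s : int) (N : nat) (x y a b c : rat) :
  x != 0 -> y != 0 -> theta_phi r s N (x, y) = (a, b, c) ->
  a * b = 2 * r%:~R * N%:R.
Proof.
move=> x0 y0 [<- <- _]; move: (r%:~R : rat) (N%:R : rat) => ? ?.
by field; rewrite x0 y0.
Qed.

(** By the equation of the curve, [x (3 x^2 + 4 s n x - D n^2)] is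
    [2 y^2 + x (x^2 + D n^2) = 2 y (a x) + x (c y)], that is [2 x y (a + c / 2)]. *)
Lemma theta_tangent_slope (r s : int) (N : nat) (x y a b c : rat) :
  let E := theta_curve r s N in
  on_curve E (Some (x, y)) -> y != 0 -> theta_phi r s N (x, y) = (a, b, c) ->
  (3 * x ^+ 2 + 2 * ca2 E * x + ca4 E) / (2 * y) = a + c / 2.
Proof.
move=> E hE y0 hphi; have [x0 ey ecy ex] := theta_phi_coords hE y0 hphi.
move: ecy ex; rewrite {hE hphi}/E /=.
move: (r%:~R : rat) (s%:~R : rat) (N%:R : rat) => {}r {}s n ecy ex.
have y20 : 2 * y != 0 by rewrite mulf_neq0.
apply: (mulIf y20); rewrite divfK //.
transitivity (2 * a * y + c * y); last by field.
have -> : 3 * x ^+ 2 + 2 * (2 * s * n) * x + - ((r ^+ 2 - s ^+ 2) * n ^+ 2) =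
  4 * x ^+ 2 + 4 * s * n * x - (x ^+ 2 + (r ^+ 2 - s ^+ 2) * n ^+ 2) by ring.
transitivity (2 * x * (2 * x + 2 * s * n) - c * y); first by rewrite ecy; ring.
by rewrite [in _ + 2 * s * n]ex ey; ring.
Qed.

Lemma theta_double_coords (r s : int) (N : nat) (x y a b c : rat) :
  r != 0 -> theta_triple r s N a b c ->
  on_curve (theta_curve r s N) (Some (x, y)) -> y != 0 ->
  theta_phi r s N (x, y) = (a, b, c) ->
  chord_tangent (theta_curve r s N) (Some (x, y)) (Some (x, y)) =
    Some (c ^+ 2 / 4, c * (a ^+ 2 - b ^+ 2) / 8).
Proof.
move=> r0 [hc hab] hE y0 hphi; have [x0 ey _ ex] := theta_phi_coords hE y0 hphi.
have yNy : y != - y.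
  by rewrite -addr_eq0 -mulr2n mulrn_eq0.
rewrite /chord_tangent eqxx (negbTE yNy) (theta_tangent_slope hE y0 hphi).
rewrite /line_sum /= {hE hphi yNy}.
have {}r0 : (r%:~R : rat) != 0 by rewrite intr_eq0.
move: (r%:~R : rat) (s%:~R : rat) (N%:R : rat) r0 hc hab ex.
move=> {}r {}s n r0 hc hab ex.
have ex3 : (a + c / 2) ^+ 2 - 2 * s * n - x - x = c ^+ 2 / 4.
  transitivity ((a + c / 2) ^+ 2 - 2 * s * n - 2 * x); first by ring.
  by rewrite ex; field.
congr (Some (_, _)); rewrite ex3 // ey.
have en : n = a * b / (2 * r) by rewrite hab; field.
have {}ex : x = (a * (a + c) - s / r * a * b) / 2.
  transitivity (2 * x / 2); first by field.
  by rewrite ex en; field.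
transitivity (c / 2 * (x - a * c / 2 - c ^+ 2 / 4)); first by field.
by rewrite -hc ex; field.
Qed.

(** Completing the square, the numerator of [a1] is
    [(c^2 + 2 s a b / r)^2 - 4 a^2 b^2]; by the triple relation this is
    [(a^2 + b^2)^2 - 4 a^2 b^2], a perfect square. *)
Lemma triple_a1E (r s : int) (N : nat) (a b c : rat) :
  r != 0 -> theta_triple r s N a b c ->
  triple_a1 r s a b c = (b ^+ 2 - a ^+ 2) / (2 * c).
Proof.
move=> r0 [hc _]; rewrite /triple_a1.
have {}r0 : (r%:~R : rat) != 0 by rewrite intr_eq0.
move: (r%:~R : rat) (s%:~R : rat) r0 hc => {}r {}s r0 hc.
have -> : c ^+ 4 - 4 * (r ^+ 2 - s ^+ 2) * a ^+ 2 * b ^+ 2 / r ^+ 2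
          + 4 * s * a * b * c ^+ 2 / r = (b ^+ 2 - a ^+ 2) ^+ 2.
  have -> : c ^+ 4 = (c ^+ 2) ^+ 2 by ring.
  by rewrite -hc; field.
have [->|d0] := eqVneq (b ^+ 2 - a ^+ 2) 0; first by rewrite expr0n /= !mul0r.
by rewrite expr2 -mulf_div divff // mulr1.
Qed.

(** Over the common denominator [2 c (b^2 - a^2)] the terms in [r] and [s]
    cancel and only [2 c^4] remains; this is the factor of [psi] that determines
    the abscissa of the doubled point. *)
Lemma triple1_sum (r s : int) (a b c : rat) :
  r != 0 -> c != 0 -> b ^+ 2 - a ^+ 2 != 0 ->
  triple_a1 r s a b c + triple_c1 r s a b c - s%:~R / r%:~R * triple_b1 a b c =
    c ^+ 3 / (b ^+ 2 - a ^+ 2).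
Proof.
rewrite /triple_a1 /triple_b1 /triple_c1 -(intr_eq0 rat).
move: (r%:~R : rat) (s%:~R : rat) => {}r {}s r0 c0 d0.
by field; rewrite r0 c0 d0.
Qed.

Lemma theta_triple1_coords (r s : int) (N : nat) (a b c x y : rat) :
  r != 0 -> theta_triple r s N a b c -> b ^+ 2 - a ^+ 2 != 0 ->
  on_curve (theta_curve r s N) (Some (x, y)) -> y != 0 ->
  theta_phi r s N (x, y) =
    (triple_a1 r s a b c, triple_b1 a b c, triple_c1 r s a b c) ->
  x = c ^+ 2 / 4 /\ y = c * (b ^+ 2 - a ^+ 2) / 8.
Proof.
move=> r0 habc d0 hE y0 hphi.
have [x0 ey _ ex] := theta_phi_coords hE y0 hphi.
have hab := theta_phi_mul x0 y0 hphi.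
have ea := triple_a1E r0 habc.
(* If c were 0, division by zero would give a1 = 0 and then y = 0. *)
have c0 : c != 0.
  by apply: contraNneq y0 => e; rewrite ey ea e mulr0 invr0 mulr0 mul0r.
have hsum := triple1_sum s r0 c0 d0.
have {}r0 : (r%:~R : rat) != 0 by rewrite intr_eq0.
move: (triple_a1 r s a b c) (triple_b1 a b c) (triple_c1 r s a b c)
  ea hsum hab ey ex => a1 b1 c1 ea hsum hab ey ex.
have {ex hab} exs : 2 * x = a1 * (a1 + c1 - s%:~R / r%:~R * b1).
  have en : (N%:R : rat) = a1 * b1 / (2 * r%:~R).
    by rewrite hab mulrC mulKf // mulf_neq0.
  rewrite ex en; move: (r%:~R : rat) (s%:~R : rat) r0 => q t q0.
  by field.
have ex : x = c ^+ 2 / 4.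
  transitivity (2 * x / 2); first by field.
  by rewrite exs hsum ea; field; rewrite c0 d0.
by split; rewrite // ey ex ea; field.
Qed.

Theorem theorem4p1 (R : realType) (theta : R) (r s : int) (N : nat)
    (htheta : 0 < theta < pi)
    (hcos : cos theta = s%:~R / r%:~R)
    (hsr : 0 <= `|s| < r)
    (hgcd : gcdz r s = 1)
    (hNpos : (0 < N)%N)
    (hN : theta_congruent r s N)
    (a0 b0 c0 : rat)
    (htriple : theta_triple r s N a0 b0 c0)
    (hd0 : b0 ^+ 2 - a0 ^+ 2 != 0)
    (hd0' : b0 ^+ 2 - a0 ^+ 2 != 2 * a0 * c0)
    (P0 P1 : ec_point (theta_curve r s N))
    (x0 y0 x1 y1 : rat)
    (hP0 : sval P0 = Some (x0, y0))
    (hy0 : y0 != 0)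
    (hphi0 : theta_phi r s N (x0, y0) = (a0, b0, c0))
    (hP1 : sval P1 = Some (x1, y1))
    (hy1 : y1 != 0)
    (hphi1 : theta_phi r s N (x1, y1) =
       (triple_a1 r s a0 b0 c0, triple_b1 a0 b0 c0, triple_c1 r s a0 b0 c0)) :
  sval (ec_double P0) = Some (x1, - y1).
Proof.
have r0 : r != 0 by case/andP: hsr => h0 h; rewrite gt_eqF // (le_lt_trans h0).
have hE0 := svalP P0; rewrite hP0 in hE0.
have hE1 := svalP P1; rewrite hP1 in hE1.
have [-> ->] := theta_triple1_coords r0 htriple hd0 hE1 hy1 hphi1.
rewrite /ec_double /ec_add [sval (exist _ _ _)]/= hP0.
rewrite (theta_double_coords r0 htriple hE0 hy0 hphi0).
by congr (Some (_, _)); field.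
Qed.
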